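(* Let $X=(V,E)$ be a simple finite graph with $n$ vertices and with eigenvalues $\lambda_0\ge\lambda_1\ge\cdots\ge\lambda_{n-1}$. Let $F$ be a matching of $X$ [respectively of the complement $\overline{X}$], and let $\mu_0\ge\mu_1\ge\cdots\ge\mu_{n-1}$ be the eigenvalues of $X-F$ [respectively of $X+F$]. Then $|\mu_j-\lambda_j|\le 1$ for all $j\in\{0,1,\dots,n-1\}$.
   Context: For a simple finite graph $X=(V,E)$ with $n$ vertices, the eigenvalues of $X$ are the eigenvalues (with multiplicity, in decreasing order) of its adjacency matrix $A$, where $A_{v,w}=1$ if $v$ and $w$ are joined by an edge and $A_{v,w}=0$ otherwise (in particular $A_{v,v}=0$). A matching of a graph is a subset $M$ of its edge set such that every vertex is incident with at most one edge of $M$. Complement: if $X$ is not bipartite, $\overline{X}=(V,\overline{E})$ is the usual complement (two distinct vertices are adjacent in $\overline{X}$ if and only if they are not adjacent in $X$). If $X$ is bipartite, given with a bipartition $V=V_0\sqcup V_1$, $\overline{X}=(V,\overline{E})$ is the bipartite complement ($v\in V_0$ and $w\in V_1$ are adjacent in $\overline{X}$ if and only if they are not adjacent in $X$, and there are no edges inside $V_0$ or inside $V_1$). For a matching $F\subset E$ of $X$, $X-F$ denotes the graph $(V,E\setminus F)$. For a matching $F\subset\overline{E}$ of $\overline{X}$, $X+F$ denotes the graph $\overline{\overline{X}-F}$, that is, the graph $(V,E\cup F)$. *)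

(* Defs.v *)
From HB Require Import structures.
From mathcomp Require Import all_boot all_order all_algebra.
From mathcomp Require Import spectral complex.

Set Implicit Arguments.
Unset Strict Implicit.
Unset Printing Implicit Defensive.

Import Order.TTheory GRing.Theory Num.Theory.
Local Open Scope ring_scope.

Record sgraph (V : finType) := SGraph {
  adj :> rel V;
  adj_sym : symmetric adj;
  adj_irr : irreflexive adj
}.

Section Graphs.
Variable V : finType.
Implicit Types (X : sgraph V) (F : {set {set V}}) (L : {set V}).

Definition edges X : {set {set V}} :=
  [set [set p.1; p.2] | p : V * V & X p.1 p.2].

Definition matching X F : bool :=
  (F \subset edges X) && [forall v, #|[set e in F | v \in e]| <= 1]%N.

(* [L] stands for the bipartition of [V] into [L] and [~: L]; either part
   may be empty. *)
Definition bipartition X L : bool :=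
  [forall u, forall v, X u v ==> ((u \in L) != (v \in L))].

Definition bipartite X : bool := [exists L, bipartition X L].

Definition compl_rel X : rel V :=
  fun u v => (u != v) && ~~ X u v.

Lemma compl_sym X : symmetric (compl_rel X).
Proof. by move=> u v; rewrite /compl_rel eq_sym adj_sym. Qed.

Lemma compl_irr X : irreflexive (compl_rel X).
Proof. by move=> u; rewrite /compl_rel eqxx. Qed.

Definition compl X : sgraph V := SGraph (compl_sym X) (compl_irr X).

Definition bicompl_rel X L : rel V :=
  fun u v => ((u \in L) != (v \in L)) && ~~ X u v.

Lemma bicompl_sym X L : symmetric (bicompl_rel X L).
Proof. by move=> u v; rewrite /bicompl_rel eq_sym adj_sym. Qed.

Lemma bicompl_irr X L : irreflexive (bicompl_rel X L).
Proof. by move=> u; rewrite /bicompl_rel eqxx. Qed.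

Definition bicompl X L : sgraph V :=
  SGraph (bicompl_sym X L) (bicompl_irr X L).

(* A relation rather than a function: for a bipartite graph the complement
   depends on the bipartition with which the graph is given. *)
Inductive complement_of X : sgraph V -> Prop :=
| ComplementUsual of ~~ bipartite X : complement_of X (compl X)
| ComplementBipartite L of bipartition X L : complement_of X (bicompl X L).

Definition del_edges_rel X F : rel V :=
  fun u v => X u v && ([set u; v] \notin F).

Lemma del_edges_sym X F : symmetric (del_edges_rel X F).
Proof. by move=> u v; rewrite /del_edges_rel adj_sym setUC. Qed.

Lemma del_edges_irr X F : irreflexive (del_edges_rel X F).
Proof. by move=> u; rewrite /del_edges_rel adj_irr. Qed.

Definition del_edges X F : sgraph V :=
  SGraph (del_edges_sym X F) (del_edges_irr X F).

Definition add_edges_rel X F : rel V :=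
  fun u v => X u v || ((u != v) && ([set u; v] \in F)).

Lemma add_edges_sym X F : symmetric (add_edges_rel X F).
Proof. by move=> u v; rewrite /add_edges_rel adj_sym eq_sym setUC. Qed.

Lemma add_edges_irr X F : irreflexive (add_edges_rel X F).
Proof. by move=> u; rewrite /add_edges_rel adj_irr eqxx. Qed.

(* The edge set is [edges X :|: F] (see [edges_add]).  This agrees with the
   complement of [Xbar - F] when the same kind of complement is taken both times
   (see [add_edges_compl] and [add_edges_bicompl]); a literal iteration may
   differ, as [Xbar - F] can be bipartite although [X] is not. *)
Definition add_edges X F : sgraph V :=
  SGraph (add_edges_sym X F) (add_edges_irr X F).

Lemma mem_edges X u v : ([set u; v] \in edges X) = X u v.
Proof.
apply/imsetP/idP => [[[a b]] | Xuv]; last by exists (u, v); rewrite ?inE.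
rewrite inE /= => Xab E.
have abN: a != b by apply: contraTneq Xab => ->; rewrite adj_irr.
have: b \in [set u; v] by rewrite E set22.
have: a \in [set u; v] by rewrite E set21.
rewrite !inE => /orP[]/eqP ? /orP[]/eqP ?; subst; rewrite ?eqxx // in abN *.
by rewrite adj_sym.
Qed.

Lemma edgesP X e :
  reflect (exists u v, e = [set u; v] /\ X u v) (e \in edges X).
Proof.
apply: (iffP imsetP) => [[[u v]] | [u [v [-> Xuv]]]].
  by rewrite inE /= => Xuv ->; exists u, v; split.
by exists (u, v); rewrite ?inE.
Qed.

Lemma edges_del X F : edges (del_edges X F) = edges X :\: F.
Proof.
apply/setP => e; rewrite inE; apply/idP/idP.
  by case/edgesP=> u [v [-> /= /andP[Xuv ->]]]; rewrite mem_edges.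
case/andP=> FNe /edgesP[u [v [E Xuv]]].
by rewrite E mem_edges /= /del_edges_rel Xuv -E.
Qed.

Lemma edges_add X Xbar F :
  matching Xbar F -> edges (add_edges X F) = edges X :|: F.
Proof.
case/andP=> /subsetP sF _; apply/setP => e; rewrite inE; apply/idP/idP.
  case/edgesP=> u [v [-> /= /orP[Xuv | /andP[_ ->]]]]; last by rewrite orbT.
  by rewrite mem_edges Xuv.
case/orP=> [/edgesP[u [v [-> Xuv]]] | Fe].
  by rewrite !mem_edges /= /add_edges_rel Xuv.
have /edgesP[u [v [E Xuv]]] := sF _ Fe;
  rewrite E mem_edges /= /add_edges_rel -E Fe andbT.
by apply/orP; right; apply: contraTneq Xuv => ->; rewrite adj_irr.
Qed.

Lemma add_edges_compl X F : compl (del_edges (compl X) F) =2 add_edges X F.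
Proof.
move=> u v;
  rewrite /= /compl_rel /= /del_edges_rel /= /add_edges_rel /compl_rel.
case: eqVneq => [->|] /=; first by rewrite adj_irr.
by rewrite negb_and !negbK.
Qed.

Lemma add_edges_bicompl X L F :
    bipartition X L -> matching (bicompl X L) F ->
  bicompl (del_edges (bicompl X L) F) L =2 add_edges X F.
Proof.
move=> /forallP bipX /andP[/subsetP sF _] u v.
rewrite /= /bicompl_rel /= /del_edges_rel /= /add_edges_rel /bicompl_rel.
have := forallP (bipX u) v; have := sF [set u; v].
rewrite mem_edges /= /bicompl_rel.
case: (X u v); case: (_ \in F) => /=; case: (eqVneq u v) => [->|_];
  rewrite ?eqxx //=; case: (_ != _) => //= H; by move: (H isT).
Qed.

End Graphs.

Definition adjmx (R : pzSemiRingType) (V : finType) (X : sgraph V) :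
    'M[R]_#|V| :=
  \matrix_(i, j) (X (enum_val i) (enum_val j))%:R.

(* [s] lists the eigenvalues of [A], with their multiplicities as roots of the
   characteristic polynomial, in decreasing order. *)
Definition spectrum (R : realFieldType) n (A : 'M[R]_n) (s : n.-tuple R) :=
  sorted >=%O s /\ char_poly A = \prod_(x <- s) ('X - x%:P).

Definition graph_spectrum (R : realFieldType) (V : finType) (X : sgraph V)
    (s : #|V|.-tuple R) :=
  spectrum (adjmx R X) s.

Lemma spectrum_unique (R : realFieldType) n (A : 'M[R]_n) (s t : n.-tuple R) :
  spectrum A s -> spectrum A t -> s = t.
Proof.
move=> [s_srt sA] [t_srt tA]; apply/val_inj.
apply: (sorted_eq (leT := >=%O)) => //=; [exact: ge_trans | exact: ge_anti | ].
by apply: prod_XsubC_eq; rewrite -sA -tA.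
Qed.

Lemma spectrum_exists (R : rcfType) n (A : 'M[R]_n) :
  A^T = A -> exists s, spectrum A s.
Proof.
move=> symA; pose f := @real_complex R; pose B := map_mx f A.
have Breal : B \is a mxOver Num.real.
  by apply/mxOverP => i j; rewrite mxE; apply/complex_realP; exists (A i j).
have Bherm : B \is hermsymmx.
  apply: realsym_hermsym => //; apply/is_hermitianmxP.
  by rewrite scale1r map_mx_id // /B map_trmx symA.
have Beq := orthomx_spectralP (hermitian_normalmx Bherm).
have /mxOverP Dreal := hermitian_spectral_diag_real Bherm.
pose d j := complex.Re (spectral_diag B 0 j).
have dE j : (real_complex R : {rmorphism R -> _}) (d j)
    = spectral_diag B 0 j.
  by exact/RRe_real/Dreal.
pose s := sort >=%O (codom d).
have sz_s : size s == n by rewrite size_sort size_codom card_ord.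
exists (Tuple sz_s); split.
  by apply: sort_sorted => x y; rewrite /= orbC le_total.
have -> : \prod_(x <- Tuple sz_s) ('X - x%:P) = \prod_(j < n) ('X - (d j)%:P).
  by rewrite (perm_big (codom d)) ?perm_sort // big_image.
apply: (map_poly_inj f); rewrite map_char_poly -/B rmorph_prod /=.
under eq_bigr => j _ do rewrite map_polyXsubC dE.
set Q := spectralmx B in Beq; set D := diag_mx _ in Beq.
have Qu : Q \in unitmx by exact: spectral_unit.
have -> : char_poly B = char_poly D.
  rewrite /char_poly /char_poly_mx Beq !map_mxM map_invmx.
  set Q' := map_mx _ Q.
  have Q'u : Q' \in unitmx by rewrite map_unitmx.
  rewrite -[X in X - _](mulKmx Q'u) scalar_mxC mulmxA -mulmxBl -mulmxBr.
  by rewrite !det_mulmx mulrAC -det_mulmx mulVmx // det1 mul1r.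
rewrite char_poly_trig ?diag_mx_is_trig //.
by apply: eq_bigr => j _; rewrite mxE eqxx.
Qed.

Lemma graph_spectrum_exists (R : rcfType) (V : finType) (X : sgraph V) :
  exists s : #|V|.-tuple R, graph_spectrum X s.
Proof. by apply/spectrum_exists/matrixP => i j; rewrite !mxE adj_sym. Qed.

(* Main.v *)
Require Import Defs.
From mathcomp Require Import all_boot all_order all_algebra.
From mathcomp Require Import perm spectral complex.

Import Order.TTheory GRing.Theory Num.Theory.
Local Open Scope ring_scope.
Local Open Scope sesquilinear_scope.

(** Deleting or adding the edges of a matching changes the adjacency matrix only
    at the entries indexed by pairs of the matching, and each row contains at
    most one such entry.  The difference [E] of the two adjacency matrices is
    thus symmetric with absolute row sums at most 1, which bounds its quadratic
    form: the Schur test [schur_test] gives [x E x^* <= |x|^2].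

    What remains is Weyl's inequality [weyl_le]: if the form of [A - B] is
    at most [c |x|^2], then the [j]-th eigenvalues in decreasing order satisfy
    [s_j - t_j <= c].  Indeed the first [j + 1] eigenvectors of [A] and the last
    [n - j] eigenvectors of [B] span spaces whose dimensions add up to [n + 1],
    so these spaces share a vector [x != 0], and there
    [s_j |x|^2 <= x A x^*] while [x B x^* <= t_j |x|^2]
    ([rayleigh_ge], [rayleigh_le]).  Exchanging [A] and [B] bounds the absolute
    value ([weyl_symmetric]).

    The spectral theorem is used over an algebraically closed field, so a
    real symmetric matrix is regarded as a Hermitian matrix over [R[i]]; the
    roots of its characteristic polynomial are the same there, with the same
    order. *)

Section HermitianForms.
Local Set Implicit Arguments.
Local Unset Strict Implicit.
Variable C : numClosedFieldType.

Lemma dotmx_sum n (x y : 'rV[C]_n) :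
  dotmx x y = \sum_j x 0 j * (y 0 j)^*.
Proof. by rewrite dotmxE mxE; apply: eq_bigr => j _; rewrite !mxE. Qed.

Lemma dotmx_unitary m n (V : 'M[C]_(m, n)) (x y : 'rV[C]_m) :
  V \is unitarymx -> dotmx (x *m V) (y *m V) = dotmx x y.
Proof.
move=> /unitarymxP VV1; rewrite !dotmxE trmx_mul map_mxM.
by rewrite mulmxA -[x *m V *m _]mulmxA VV1 mulmx1.
Qed.

Lemma rowsub_unitary m n p (f : 'I_m -> 'I_n) (Q : 'M[C]_(n, p)) :
  injective f -> Q \is unitarymx -> rowsub f Q \is unitarymx.
Proof.
move=> f_inj /row_unitarymxP Qo; apply/row_unitarymxP => i j.
by rewrite !row_rowsub Qo (inj_eq f_inj).
Qed.

Lemma char_poly_similar n (Q A : 'M[C]_n) :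
  Q \in unitmx -> char_poly (invmx Q *m A *m Q) = char_poly A.
Proof.
move=> Qu; rewrite /char_poly /char_poly_mx !map_mxM map_invmx.
set Q' := map_mx _ Q.
have Q'u : Q' \in unitmx by rewrite map_unitmx.
rewrite -[X in X - _](mulKmx Q'u) scalar_mxC mulmxA -mulmxBl -mulmxBr.
by rewrite !det_mulmx mulrAC -det_mulmx mulVmx // det1 mul1r.
Qed.

(** The spectral theorem orders the eigenvalues arbitrarily; as [s] lists the
    same roots of the characteristic polynomial, permuting the rows of [Q] makes
    the [i]-th row an eigenvector for the [i]-th entry of [s]. *)
Lemma hermitian_eigenbasis n (A : 'M[C]_n) (s : n.-tuple C) :
    A \is hermsymmx -> char_poly A = \prod_(x <- s) ('X - x%:P) ->
  exists2 Q : 'M[C]_n, Q \is unitarymx &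
    Q *m A = diag_mx (\row_i tnth s i) *m Q.
Proof.
move=> Aherm sA; set Q := spectralmx A; set d := spectral_diag A.
have AE : A = invmx Q *m diag_mx d *m Q.
  exact: orthomx_spectralP (hermitian_normalmx Aherm).
have Quni : Q \is unitarymx by exact: spectral_unitarymx.
have Qu : Q \in unitmx by exact: spectral_unit.
have /tuple_permP[p sE] : perm_eq s (mktuple (d 0)).
  apply: prod_XsubC_eq; rewrite -sA AE char_poly_similar //.
  rewrite char_poly_trig ?diag_mx_is_trig // big_map big_enum /=.
  by apply: eq_bigr => i _; rewrite mxE eqxx.
exists (rowsub p Q); first exact: rowsub_unitary perm_inj Quni.
have QA : Q *m A = diag_mx d *m Q by rewrite AE -mulmxA mulKVmx.
rewrite mul_rowsub_mx QA !mul_diag_mx; apply/matrixP => i j; rewrite !mxE.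
congr (_ * _); rewrite (tnth_nth 0) sE -(tnth_nth 0 [tuple _ | _ < _]).
by rewrite !tnth_mktuple.
Qed.

(* [V] is rectangular so that its rows may form only a part of an orthonormal
   eigenbasis of [A]. *)
Section Rayleigh.
Variables (m n : nat) (A : 'M[C]_n) (V : 'M[C]_(m, n)) (d : 'rV[C]_m).
Hypotheses (V_uni : V \is unitarymx) (VA : V *m A = diag_mx d *m V).

Lemma dotmx_eigenbasis (y : 'rV[C]_m) :
  dotmx (y *m V *m A) (y *m V) = \sum_i d 0 i * `|y 0 i| ^+ 2.
Proof.
rewrite -mulmxA VA mulmxA dotmx_unitary // dotmx_sum.
by apply: eq_bigr => i _; rewrite mul_mx_diag mxE normCK -mulrA mulrCA.
Qed.

Lemma rayleigh_ge (a : C) (x : 'rV[C]_n) :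
    (x <= V)%MS -> (forall i, a <= d 0 i) ->
  a * dotmx x x <= dotmx (x *m A) x.
Proof.
move=> /submxP[y ->] a_le; rewrite dotmx_eigenbasis dotmx_unitary // dotmx_sum.
rewrite mulr_sumr; apply: ler_sum => i _.
by rewrite -normCK ler_wpM2r ?exprn_ge0.
Qed.

Lemma rayleigh_le (a : C) (x : 'rV[C]_n) :
    (x <= V)%MS -> (forall i, d 0 i <= a) ->
  dotmx (x *m A) x <= a * dotmx x x.
Proof.
move=> /submxP[y ->] a_ge; rewrite dotmx_eigenbasis dotmx_unitary // dotmx_sum.
rewrite mulr_sumr; apply: ler_sum => i _.
by rewrite -normCK ler_wpM2r ?exprn_ge0.
Qed.

End Rayleigh.

Lemma sorted_ge_tnth n (s : n.-tuple C) (i j : 'I_n) :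
  sorted >=%O s -> (i <= j)%N -> tnth s j <= tnth s i.
Proof.
move=> s_srt ij; rewrite !(tnth_nth 0).
have geT : transitive (>=%O : rel C) by move=> x y z xy yz; apply: le_trans yz xy.
by apply: (sorted_leq_nth geT (@lexx _ _) _ s_srt) ij; rewrite inE size_tuple.
Qed.

(** Weyl's inequality, by comparing both forms at a nonzero vector common to the
    span of the first [j + 1] eigenvectors of [A], where the form of [A] is
    large, and the span of the last [n - j] eigenvectors of [B], where the form
    of [B] is small. *)
Lemma weyl_le n (A B : 'M[C]_n) (s t : n.-tuple C) (c : C) :
    A \is hermsymmx -> B \is hermsymmx ->
    sorted >=%O s -> char_poly A = \prod_(x <- s) ('X - x%:P) ->
    sorted >=%O t -> char_poly B = \prod_(x <- t) ('X - x%:P) ->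
    (forall x, dotmx (x *m (A - B)) x <= c * dotmx x x) ->
  forall j, tnth s j - tnth t j <= c.
Proof.
move=> Ah Bh s_srt sA t_srt tB AB j.
have [P Puni PA] := hermitian_eigenbasis Ah sA.
have [Q Quni QB] := hermitian_eigenbasis Bh tB.
pose f (i : 'I_j.+1) : 'I_n := widen_ord (ltn_ord j) i.
have g_lt (i : 'I_(n - j)) : (j + i < n)%N by rewrite -ltn_subRL.
pose g (i : 'I_(n - j)) : 'I_n := Ordinal (g_lt i).
have f_inj : injective f by move=> i k /(congr1 val) /= /val_inj.
have g_inj : injective g by move=> i k /(congr1 val) /= /addnI /val_inj.
have U_uni := rowsub_unitary f_inj Puni; set U := rowsub f P in U_uni.
have W_uni := rowsub_unitary g_inj Quni; set W := rowsub g Q in W_uni.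
have subE k (h : 'I_k -> 'I_n) (M N : 'M[C]_n) (d : 'rV[C]_n) :
    M *m N = diag_mx d *m M ->
    rowsub h M *m N = diag_mx (colsub h d) *m rowsub h M.
  move=> E; rewrite mul_rowsub_mx E !mul_diag_mx.
  by apply/matrixP => i l; rewrite !mxE.
have UA := subE _ f _ _ _ PA; have WB := subE _ g _ _ _ QB.
(* The ranks [j + 1] and [n - j] add up to more than [n]. *)
have /rowV0Pn[x] : (U :&: W)%MS != 0.
  rewrite -mxrank_eq0 -lt0n -(ltn_add2l (\rank (U + W))) addn0.
  rewrite mxrank_sum_cap (mxrank_unitary U_uni) (mxrank_unitary W_uni).
  rewrite addSn subnKC ?ltnS ?rank_leq_col //; exact/ltnW.
rewrite sub_capmx => /andP[xU xW] x0.
have x_gt0 : 0 < dotmx x x by rewrite dnorm_gt0.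
rewrite -(ler_pM2r x_gt0) mulrBl; apply: le_trans (AB x).
rewrite mulmxBr linearBl /=; apply: lerB.
  apply: rayleigh_ge U_uni UA _ _ xU _ => i; rewrite !mxE.
  by apply: sorted_ge_tnth => //=; rewrite -ltnS.
apply: rayleigh_le W_uni WB _ _ xW _ => i; rewrite !mxE.
by apply: sorted_ge_tnth => //=; rewrite leq_addr.
Qed.

(** By the mean inequality [2 |x_i| |x_j| <= |x_i|^2 + |x_j|^2], the form is at
    most the mean of the sums of [|E i j| |x_i|^2] and of [|E i j| |x_j|^2];
    these are equal because [|E i j|] is symmetric, and the row sums bound
    the first. *)
Lemma schur_test n (E : 'M[C]_n) (c : C) (x : 'rV[C]_n) :
    E \is hermsymmx -> (forall i, \sum_j `|E i j| <= c) ->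
  dotmx (x *m E) x <= c * dotmx x x.
Proof.
move=> /is_hermitianmxP; rewrite expr0 scale1r => EE E_le.
have Ec i j : (E i j)^* = E j i by rewrite [in RHS]EE !mxE.
have Esym i j : `|E i j| = `|E j i| by rewrite -Ec norm_conjC.
have xE_E : dotmx (x *m E) x = \sum_i \sum_j x 0 i * E i j * (x 0 j)^*.
  rewrite dotmx_sum exchange_big; apply: eq_bigr => j _.
  by rewrite mxE mulr_suml.
have xE_real : dotmx (x *m E) x \is Num.real.
  apply/CrealP; rewrite xE_E [RHS]exchange_big rmorph_sum; apply: eq_bigr => i _.
  rewrite rmorph_sum; apply: eq_bigr => j _.
  by rewrite !rmorphM /= conjCK Ec mulrC [_^* * _]mulrC mulrA.
apply: le_trans (real_ler_norm xE_real) _; rewrite xE_E.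
have sqE : \sum_i \sum_j `|E i j| * `|x 0 j| ^+ 2 =
           \sum_i \sum_j `|E i j| * `|x 0 i| ^+ 2.
  rewrite exchange_big; apply: eq_bigr => i _; apply: eq_bigr => j _.
  by rewrite Esym.
apply: le_trans (_ : \sum_i \sum_j `|E i j| * `|x 0 i| ^+ 2 <= _); last first.
  rewrite dotmx_sum mulr_sumr; apply: ler_sum => i _.
  by rewrite -normCK -mulr_suml ler_wpM2r ?exprn_ge0.
(* One of the two copies of the doubled right-hand side is transposed. *)
rewrite -(ler_pMn2r (isT : 0 < 2)%N) [leRHS]mulr2n -{2}sqE -big_split /=.
apply: le_trans (_ : (\sum_i \sum_j `|E i j| * (`|x 0 i| * `|x 0 j|)) *+ 2 <= _).
  rewrite ler_pMn2r //; apply: le_trans (ler_norm_sum _ _ _) _.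
  apply: ler_sum => i _; apply: le_trans (ler_norm_sum _ _ _) _.
  by apply: ler_sum => j _; rewrite !normrM norm_conjC mulrAC mulrC.
rewrite -sumrMnl; apply: ler_sum => i _; rewrite -sumrMnl -big_split /=.
apply: ler_sum => j _; rewrite -mulrnAr -mulrDr ler_wpM2l //.
by apply: real_leif_mean_square_scaled; apply: normr_real.
Qed.

End HermitianForms.

Section RealPerturbation.
Local Set Implicit Arguments.
Local Unset Strict Implicit.
Variables (R : rcfType) (n : nat).

(** The embedding of [R] into [R[i]] turns symmetric matrices into Hermitian
    ones and preserves characteristic polynomials, order and absolute values, so
    the Hermitian inequality descends to [R]. *)
Lemma weyl_symmetric_le (A B : 'M[R]_n) (s t : n.-tuple R) (c : R) :
    A^T = A -> B^T = B -> spectrum A s -> spectrum B t ->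
    (forall i, \sum_j `|A i j - B i j| <= c) ->
  forall j, tnth s j - tnth t j <= c.
Proof.
pose f : {rmorphism R -> R[i]} := real_complex R.
have herm (M : 'M[R]_n) : M^T = M -> map_mx f M \is hermsymmx.
  move=> Msym; apply: realsym_hermsym; last first.
    by apply/mxOverP => i j; rewrite mxE; apply/complex_realP; exists (M i j).
  by apply/is_hermitianmxP; rewrite scale1r map_mx_id // map_trmx Msym.
have f_spec (M : 'M[R]_n) (u : n.-tuple R) : spectrum M u ->
    sorted >=%O [tuple of map f u] /\
    char_poly (map_mx f M) = \prod_(x <- [tuple of map f u]) ('X - x%:P).
  case=> u_srt uM; split.
    by rewrite /= sorted_map; apply: sub_sorted u_srt => x y; rewrite /= lecR.
  rewrite -map_char_poly uM rmorph_prod big_map /=.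
  by apply: eq_bigr => x _; rewrite map_polyXsubC.
move=> Asym Bsym /f_spec[s_srt sA] /f_spec[t_srt tB] AB j.
rewrite -lecR rmorphB /=.
have := @weyl_le _ _ _ _ _ _ (f c) (herm _ Asym) (herm _ Bsym) s_srt sA t_srt tB.
rewrite -map_mxB => /(_ _ j); rewrite !tnth_map; apply=> x.
apply: schur_test => [|i]; first by apply: herm; rewrite linearB /= Asym Bsym.
apply: le_trans (_ : f (\sum_j `|A i j - B i j|) <= _); last by rewrite lecR.
rewrite rmorph_sum; apply: ler_sum => k _; rewrite !mxE.
by rewrite normc_def /= expr0n addr0 sqrtr_sqr.
Qed.

Lemma weyl_symmetric (A B : 'M[R]_n) (s t : n.-tuple R) (c : R) :
    A^T = A -> B^T = B -> spectrum A s -> spectrum B t ->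
    (forall i, \sum_j `|A i j - B i j| <= c) ->
  forall j, `|tnth s j - tnth t j| <= c.
Proof.
move=> Asym Bsym sA tB AB j; rewrite ler_norml lerNl opprB.
rewrite (weyl_symmetric_le Asym Bsym sA tB AB) andbT.
apply: weyl_symmetric_le Bsym Asym tB sA _ j => i.
by under eq_bigr => k _ do rewrite distrC.
Qed.

End RealPerturbation.

Section Matchings.
Local Set Implicit Arguments.
Local Unset Strict Implicit.
Variable V : finType.
Implicit Types (X Y : sgraph V) (F : {set {set V}}).

Lemma adjmx_sym (R : pzSemiRingType) X : (adjmx R X)^T = adjmx R X.
Proof. by apply/matrixP => i j; rewrite !mxE adj_sym. Qed.

(** Distinct partners [v] of [u] give distinct edges [[set u; v]] of the matching
    at [u], because none of these edges is a loop. *)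
Lemma matching_partner Y F u :
  matching Y F -> (#|[set v | [set u; v] \in F]| <= 1)%N.
Proof.
case/andP=> /subsetP sF /forallP/(_ u); apply: leq_trans.
have uN v : [set u; v] \in F -> v != u.
  by move/sF; rewrite mem_edges; apply: contraTneq => ->; rewrite adj_irr.
rewrite -(card_in_imset (f := fun v => [set u; v])); last first.
  move=> v w; rewrite !inE => /uN vu _ /setP/(_ v).
  by rewrite !inE eqxx orbT (negPf vu) /= => /esym/eqP.
apply/subset_leq_card/subsetP => e /imsetP[v]; rewrite !inE => vF ->.
by rewrite vF !inE eqxx.
Qed.

(** Deletion and addition are the same situation: two graphs that agree outside
    the pairs of a matching.  The matching lives in a third graph [Y], which is
    the original graph for deletion and its complement for addition. *)
Lemma matching_perturbation (R : rcfType) X X' Y F (s t : #|V|.-tuple R) :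
    matching Y F ->
    (forall u v, [set u; v] \notin F -> X u v = X' u v) ->
    graph_spectrum X s -> graph_spectrum X' t ->
  forall j, `|tnth s j - tnth t j| <= 1.
Proof.
move=> FY XX' sX tX'.
apply: weyl_symmetric (adjmx_sym _ X) (adjmx_sym _ X') sX tX' _ => i.
set u := enum_val i.
apply: le_trans (_ : \sum_(v : V) ([set u; v] \in F)%:R <= _); last first.
  rewrite -natr_sum -big_mkcond /= sum1dep_card (ler_nat _ _ 1%N).
  exact: matching_partner FY.
rewrite (reindex _ (onW_bij _ (@enum_val_bij V))) /=; apply: ler_sum => j _.
rewrite !mxE; have := XX' u (enum_val j).
case: (_ \in F) => /= [_ | -> //]; last by rewrite subrr normr0.
by do 2!case: (adj _ _ _); rewrite ?subrr ?subr0 ?sub0r ?normrN ?normr0 ?normr1.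
Qed.

End Matchings.

Theorem proposition2 (R : rcfType) (V : finType) (X : sgraph V)
    (lambda : #|V|.-tuple R) (Hlambda : graph_spectrum X lambda) :
  (forall (F : {set {set V}}) (mu : #|V|.-tuple R),
      matching X F ->
      graph_spectrum (del_edges X F) mu ->
      forall j : 'I_#|V|, `|tnth mu j - tnth lambda j| <= 1)
  /\
  (forall (Xbar : sgraph V) (F : {set {set V}}) (mu : #|V|.-tuple R),
      complement_of X Xbar ->
      matching Xbar F ->
      graph_spectrum (add_edges X F) mu ->
      forall j : 'I_#|V|, `|tnth mu j - tnth lambda j| <= 1).
Proof.
split=> [F mu FX Hmu | Xbar F mu _ FXbar Hmu].
  apply: matching_perturbation FX _ Hmu Hlambda => u v uvF.
  by rewrite /= /del_edges_rel uvF andbT.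
apply: matching_perturbation FXbar _ Hmu Hlambda => u v /negPf uvF.
by rewrite /= /add_edges_rel uvF andbF orbF.
Qed.
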